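(* Let $n\ge 1$ be an integer and let $\mathbf d\in\mathbb R^n$ be arbitrary. Let $$\mathcal X_{\mathbf d}=\{(\mathbf x,\mathbf z,t)\in\mathbb R^n\times\{0,1\}^n\times\mathbb R:\ t\ge(\mathbf d^\top\mathbf x)^2,\ x_iz_i\ge 0,\ x_i(1-z_i)\le 0,\ i=1,\dots,n\}.$$ Then the closure of the convex hull of $\mathcal X_{\mathbf d}$ is the set of all $(\mathbf x,\mathbf z,t)\in\mathbb R^n\times[0,1]^n\times\mathbb R$ satisfying $$t\ \ge\ \frac{(\mathbf d^\top\mathbf x)_+^2}{\min\left\{1,\ \sum_{i\in \mathrm{supp}_+(\mathbf d)}z_i+\sum_{i\in \mathrm{supp}_-(\mathbf d)}(1-z_i)\right\}}+\frac{(\mathbf d^\top\mathbf x)_-^2}{\min\left\{1,\ \sum_{i\in \mathrm{supp}_-(\mathbf d)}z_i+\sum_{i\in \mathrm{supp}_+(\mathbf d)}(1-z_i)\right\}}.$$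
   Context: For $c\in\mathbb R$, $(c)_+=\max\{c,0\}$ and $(c)_-=\min\{c,0\}$; $(c)_\pm^2$ denotes the square of $(c)_\pm$. For $\mathbf d\in\mathbb R^n$, $\mathrm{supp}_+(\mathbf d)=\{i:d_i>0\}$ and $\mathrm{supp}_-(\mathbf d)=\{i:d_i<0\}$. Convention: $0/0=0$, and $a/0=+\infty$ for $a>0$ (so an inequality $t\ge +\infty$ is violated). Empty sums are $0$. *)

(* Defs.v *)
From mathcomp Require Import all_boot all_order all_algebra.
From mathcomp Require Import all_classical all_reals all_analysis.

Set Implicit Arguments.
Unset Strict Implicit.
Unset Printing Implicit Defensive.

Import Order.TTheory GRing.Theory Num.Theory.
Import numFieldNormedType.Exports.

Local Open Scope classical_set_scope.
Local Open Scope ring_scope.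

(* R^o is R seen as a module over itself, so that the product is an lmodType,
   with the product topology. *)
Notation xzt_space R n := ('cV[R]_n * 'cV[R]_n * R^o)%type.

Definition convex_hull (R : numDomainType) (M : lmodType R) (A : set M) : set M :=
  smallest (@convex_set R M) A.

Definition dot (R : realType) (n : nat) (d x : 'cV[R]_n) : R :=
  (d^T *m x) 0 0.

Definition pos_part (R : realType) (c : R) : R := Num.max c 0.
Definition neg_part (R : realType) (c : R) : R := Num.min c 0.

Definition X_set (R : realType) (n : nat) (d : 'cV[R]_n) : set (xzt_space R n) :=
  [set p : xzt_space R n | let: (x, z, t) := p in
    [/\ forall i, z i 0 = 0 \/ z i 0 = 1,
        dot d x ^+ 2 <= t
      & forall i, 0 <= x i 0 * z i 0 /\ x i 0 * (1 - z i 0) <= 0]].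

Definition den_pos (R : realType) (n : nat) (d z : 'cV[R]_n) : R :=
  Num.min 1 (\sum_(i < n | 0 < d i 0) z i 0
             + \sum_(i < n | d i 0 < 0) (1 - z i 0)).

Definition den_neg (R : realType) (n : nat) (d z : 'cV[R]_n) : R :=
  Num.min 1 (\sum_(i < n | d i 0 < 0) z i 0
             + \sum_(i < n | 0 < d i 0) (1 - z i 0)).

(* The quotients are taken in \bar R, where 0^-1 = +oo and 0 * +oo = 0; hence
   0 / 0 = 0 and a / 0 = +oo for a > 0. *)
Definition hull_formula (R : realType) (n : nat) (d : 'cV[R]_n) :
    set (xzt_space R n) :=
  [set p : xzt_space R n | let: (x, z, t) := p in
    (forall i, 0 <= z i 0 <= 1) /\
    ((pos_part (dot d x) ^+ 2)%:E / (den_pos d z)%:E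
     + (neg_part (dot d x) ^+ 2)%:E / (den_neg d z)%:E <= t%:E)%E].

Lemma div0_ereal (R : realType) : ((0 : R)%:E / (0 : R)%:E = 0)%E.
Proof. by rewrite mul0e. Qed.

Lemma divr0_ereal (R : realType) (a : R) :
  0 < a -> (a%:E / (0 : R)%:E = +oo)%E.
Proof. by move=> a0; rewrite inve0 gt0_muley ?lte_fin. Qed.

(* Main.v *)
Require Import Defs.
From mathcomp Require Import all_boot all_order all_algebra.
From mathcomp Require Import all_classical all_reals all_analysis.
From mathcomp Require Import ring lra.

Import Order.TTheory GRing.Theory Num.Theory.
Import numFieldNormedType.Exports.
Local Open Scope classical_set_scope.
Local Open Scope ring_scope.

(* Write s = d^T x, L(z) = sum_(supp+) z_i + sum_(supp-) (1 - z_i) and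
   m = min(1, L(z)). Replacing d by -d leaves X_d unchanged, flips the sign of s
   and swaps the two denominators, so only the case s > 0 matters, where the
   formula reads s^2 <= t m.

   Outer inclusion: s^2 <= t m is the conjunction of the affine inequalities
   2 l s - l^2 <= t and 2 l s - l^2 L(z) <= t over l >= 0. They hold on X_d
   because there either L(z) >= 1 or s <= 0.

   Inner inclusion: since X_d contains the rays (k r, v, 0) with d^T r = 0 and
   v the sign pattern of r, the closed hull is invariant under x -> x + r for
   d^T r = 0, so x only matters through s. It then suffices to write z as
   sum_i l_i u^i + (1 - m) w with sum_i l_i = m and the i-th coordinate of u^i
   equal to 1 (if d_i > 0) or 0 (if d_i < 0): at u^i the variable x_i alone can
   carry d^T x = s / m at cost t / m, and at w take x = 0. *)

(** * Convex combinations and affine inequalities in a convex hull *)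

Section ConvexHull.
Context {R : realType} {M : lmodType R}.
Implicit Types (A : set M) (p q : M).

Lemma subset_convex_hull A : A `<=` convex_hull A.
Proof. exact: sub_smallest. Qed.

Lemma convex_hull_segment A p q (a : R) :
  convex_hull A p -> convex_hull A q -> 0 <= a <= 1 ->
  convex_hull A (a *: p + (1 - a) *: q).
Proof.
move=> hp hq /andP[a0 a1] C [cC AC].
have Cp : p \in C by apply: mem_set; exact: (hp C (conj cC AC)).
have Cq : q \in C by apply: mem_set; exact: (hq C (conj cC AC)).
exact/set_mem/(cC p q (Itv01 a0 a1) Cp Cq).
Qed.

(** Points are merged one at a time by renormalising weights. [q] supplies a hull point when all
    weights vanish; a point of weight zero may lie outside the hull. *)
Lemma convex_hull_cone A (I : Type) (r : seq I) (l : I -> R) (p : I -> M) q :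
  (forall i, 0 <= l i) -> (forall i, l i != 0 -> convex_hull A (p i)) ->
  convex_hull A q ->
  exists2 q', convex_hull A q' &
    \sum_(i <- r) l i *: p i = (\sum_(i <- r) l i) *: q'.
Proof.
move=> l0 hp hq; elim: r => [|i r [q' hq' IH]].
  by exists q => //; rewrite !big_nil scale0r.
rewrite !big_cons IH; set s := \sum_(j <- r) l j.
have s0 : 0 <= s by apply: sumr_ge0.
have [li0|lin0] := eqVneq (l i) 0.
  by exists q' => //; rewrite li0 scale0r !add0r.
have li0 : 0 < l i by rewrite lt_neqAle eq_sym lin0 l0.
have ls0 : 0 < l i + s by rewrite ltr_pwDl.
exists ((l i / (l i + s)) *: p i + (1 - l i / (l i + s)) *: q').
  apply: convex_hull_segment => //; first exact: hp.
  by rewrite divr_ge0 ?(ltW li0) ?(ltW ls0)// ler_pdivrMr// mul1r lerDl.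
rewrite scalerDr !scalerA; congr (_ *: _ + _ *: _).
  by rewrite mulrC divfK ?gt_eqF.
by rewrite mulrBr mulr1 mulrC divfK ?gt_eqF// addrAC subrr add0r.
Qed.

Lemma convex_hull_sum A (I : finType) (l : I -> R) (p : I -> M) q :
  (forall i, 0 <= l i) -> (forall i, l i != 0 -> convex_hull A (p i)) ->
  convex_hull A q -> \sum_i l i <= 1 ->
  convex_hull A (\sum_i l i *: p i + (1 - \sum_i l i) *: q).
Proof.
move=> l0 hp hq l1.
have [q' hq' ->] := @convex_hull_cone A _ (index_enum I) _ _ _ l0 hp hq.
by apply: convex_hull_segment; rewrite ?l1 ?sumr_ge0.
Qed.

Lemma convex_hull_affine_ge0 A (g : M -> R) :
  (forall a p q, g (a *: p + (1 - a) *: q) = a * g p + (1 - a) * g q) ->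
  (forall p, A p -> 0 <= g p) -> forall p, convex_hull A p -> 0 <= g p.
Proof.
move=> gaff gA p hp; apply: (hp [set p | 0 <= g p]); split=> //.
move=> x y a /set_mem gx /set_mem gy.
apply/mem_set; rewrite /= gaff.
by rewrite addr_ge0// mulr_ge0// ?subr_ge0.
Qed.

End ConvexHull.

(** * Closed half-spaces and limits along a segment *)

Section Closure.
Context {R : realType} {V : normedModType R}.
Implicit Types (A : set V) (p q : V).

Lemma closure_hull_affine_ge0 A (g : V -> R) : continuous g ->
  (forall a p q, g (a *: p + (1 - a) *: q) = a * g p + (1 - a) * g q) ->
  (forall p, A p -> 0 <= g p) ->
  forall p, closure (convex_hull A) p -> 0 <= g p.
Proof.
move=> gc gaff gA p; suff cl : closed [set p | 0 <= g p].
  move=> hp; apply: cl; move: p hp; apply: closureS => q.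
  exact: convex_hull_affine_ge0.
apply: (@preimage_closed _ _ g [set x | 0 <= x]); last exact: closed_ge.
by move=> ? _; exact: gc.
Qed.

Lemma closure_segment_end A p q :
  (forall e, 0 < e <= 1 -> A (p + e *: q)) -> closure A p.
Proof.
move=> Ae B nB.
have cvg : p + e *: q @[e --> (0:R)^'+] --> p.
  rewrite -[X in _ --> X]addr0 -(scale0r q).
  apply: cvgD; first exact: cvg_cst.
  by apply: cvgZl; apply: cvg_at_right_filter; exact: cvg_id.
near (0:R)^'+ => e; exists (p + e *: q); split.
  apply: Ae; apply/andP; split; near: e; first exact: nbhs_right_gt.
  exact: nbhs_right_le.
by near: e; exact: cvg.
Unshelve. all: by end_near.
Qed.

End Closure.

Section Hull.
Context {R : realType} {n : nat}.
Implicit Types (d x z : 'cV[R]_n) (s t : R) (i j : 'I_n).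

(** * The linear form and the denominators *)

Lemma dotE d x : dot d x = \sum_i d i 0 * x i 0.
Proof. by rewrite /dot mxE; apply: eq_bigr => i _; rewrite mxE. Qed.

Lemma dotNl d x : dot (- d) x = - dot d x.
Proof. by rewrite !dotE -sumrN; apply: eq_bigr => i _; rewrite mxE mulNr. Qed.

Lemma dotDr d x y : dot d (x + y) = dot d x + dot d y.
Proof. by rewrite /dot mulmxDr mxE. Qed.

Lemma dotZr d a x : dot d (a *: x) = a * dot d x.
Proof. by rewrite /dot -scalemxAr mxE. Qed.

Lemma dot0r d : dot d 0 = 0.
Proof. by rewrite /dot mulmx0 mxE. Qed.

Lemma dot_delta d i : dot d (delta_mx i 0) = d i 0.
Proof.
rewrite dotE (bigD1 i)//= big1 ?addr0 ?mxE ?eqxx ?mulr1// => j ji.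
by rewrite mxE (negbTE ji) mulr0.
Qed.

Lemma continuous_dot d : continuous (dot d).
Proof.
have -> : dot d = fun x => \sum_i d i 0 * x i 0.
  by apply/funext => x; exact: dotE.
apply: continuous_big => [|i _ x]; first exact: add_continuous.
apply: (@continuousM _ _ (cst (d i 0)) (fun x : 'cV[R]_n => x i 0)).
  exact: cst_continuous.
exact: coord_continuous.
Qed.

Lemma X_setN d : X_set (- d) = X_set d.
Proof.
by apply/seteqP; split => -[[x z] t] [] /= ? + ?; rewrite dotNl sqrrN; split.
Qed.

(* The i-th term of the sum in [den_pos d z]. *)
Definition slack d z i : R :=
  if 0 < d i 0 then z i 0 else if d i 0 < 0 then 1 - z i 0 else 0.

Lemma den_posE d z : den_pos d z = Num.min 1 (\sum_i slack d z i).
Proof.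
congr Num.min; rewrite [in LHS]big_mkcond [X in _ + X]big_mkcond -big_split/=.
apply: eq_bigr => i _; rewrite /slack.
case: ltP => [d0|_]; last by rewrite add0r.
by rewrite lt_gtF// addr0.
Qed.

Lemma den_negE d z : den_neg d z = den_pos (- d) z.
Proof.
congr (Num.min _ (_ + _)); apply: eq_bigl => i;
  by rewrite mxE ?oppr_gt0 ?oppr_lt0.
Qed.

Lemma slack_itv d z i : 0 <= z i 0 <= 1 -> 0 <= slack d z i <= 1.
Proof. by rewrite /slack => /andP[? ?]; do 2?case: ifP => _; lra. Qed.

Lemma den_pos_ge0 d z : (forall i, 0 <= z i 0 <= 1) -> 0 <= den_pos d z.
Proof.
move=> z01; rewrite den_posE le_min ler01 sumr_ge0// => i _.
by have /andP[] := slack_itv d z i (z01 i).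
Qed.

Lemma continuous_slack d i : continuous (fun z => slack d z i).
Proof.
rewrite /slack; case: (0 < d i 0); first exact: coord_continuous.
case: (d i 0 < 0) => /= z; last exact: cst_continuous.
apply: (@continuousB R R^o _ (cst 1) (fun z : 'cV[R]_n => z i 0)).
  exact: cst_continuous.
exact: coord_continuous.
Qed.

Lemma slack_affine d i a z w :
  slack d (a *: z + (1 - a) *: w) i = a * slack d z i + (1 - a) * slack d w i.
Proof. by rewrite /slack !mxE; do 2?case: ifP => _; ring. Qed.

Lemma X_set_itv d x z t i : X_set d (x, z, t) -> 0 <= z i 0 <= 1.
Proof. by case=> /(_ i)[] -> _ _; rewrite ?lexx ?ler01. Qed.

(** If no slack equals 1, integrality forces [z i 0 = 0] where [d i 0 > 0] and [z i 0 = 1] where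
    [d i 0 < 0]. The sign of [x i 0] then makes every term of [dot d x] nonpositive. *)
Lemma X_set_slack d x z t : X_set d (x, z, t) ->
  dot d x <= 0 \/ 1 <= \sum_i slack d z i.
Proof.
move=> Xp; have s01 i : 0 <= slack d z i <= 1.
  by apply: slack_itv; exact: X_set_itv Xp.
have [[i si]|s0] := pselect (exists i, slack d z i = 1); [right|left].
  by rewrite (bigD1 i)//= si lerDl sumr_ge0// => j _; have /andP[] := s01 j.
rewrite dotE sumr_le0// => i _.
have {s0} si : slack d z i <> 1 by move=> si; apply: s0; exists i.
case: Xp => /(_ i) zi _ /(_ i)[]; move: si; rewrite /slack.
case: ltgtP => [di|di|<-]; last by rewrite mul0r.
- case: zi => -> si _ h; last by case: si.
  by move: h; rewrite subr0 mulr1 pmulr_rle0.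
- case: zi => -> si h _; first by case: si; rewrite subr0.
  by move: h; rewrite mulr1 nmulr_rle0.
Qed.

(** * Outer inclusion: valid affine inequalities *)

(** For [m > 0] the left side is a concave quadratic in [l], with maximum [s ^+ 2 / m] at
    [l = s / m]. *)
Lemma pos_den_cut s m t : 0 < s -> 0 <= m -> 0 <= t ->
  (forall l, 0 <= l -> 2 * l * s - l ^+ 2 * m <= t) -> s ^+ 2 <= t * m.
Proof.
move=> s0 m0 t0 h; have [m_gt0|] := ltP 0 m.
  rewrite -ler_pdivrMr//; apply: le_trans (h (s / m) _); last first.
    by rewrite divr_ge0// ltW.
  by rewrite le_eqVlt; apply/orP; left; apply/eqP; field; rewrite gt_eqF.
move=> mle0; have m00 : m = 0 by apply/le_anti; rewrite m0 mle0.
(* For [m = 0] the bound is linear in [l]; this choice turns it into [2 * (t + 1) <= t],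
   contradicting [0 <= t]. *)
have := h ((t + 1) / s); rewrite m00 mulr0 subr0 -mulrA divfK ?gt_eqF//.
by move=> /(_ _); rewrite divr_ge0 ?addr_ge0 ?(ltW s0)// => /(_ isT); lra.
Qed.

Lemma continuous_fst_fst : continuous (fun p : xzt_space R n => p.1.1).
Proof.
by move=> p; apply: (@continuous_comp _ _ _ fst fst); exact: cvg_fst.
Qed.

Lemma continuous_fst_snd : continuous (fun p : xzt_space R n => p.1.2).
Proof.
move=> p; apply: (@continuous_comp _ _ _ fst snd); first exact: cvg_fst.
exact: cvg_snd.
Qed.

Lemma closure_hull_cube d x z t i :
  closure (convex_hull (X_set d)) (x, z, t) -> 0 <= z i 0 <= 1.
Proof.
pose zi (p : xzt_space R n) : R^o := p.1.2 i 0.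
have czi : continuous zi.
  move=> p; apply: (@continuous_comp _ _ _ (fun p : xzt_space R n => p.1.2)
    (fun z : 'cV[R]_n => z i 0)).
    exact: continuous_fst_snd.
  exact: coord_continuous.
move=> cl; apply/andP; split.
  apply: (@closure_hull_affine_ge0 R _ _ zi czi _ _ _ cl).
  - by move=> a p q; rewrite /zi/= !mxE.
  - by move=> [[x' z'] t'] /(@X_set_itv _ _ _ _ i) /andP[].
rewrite -subr_ge0.
apply: (@closure_hull_affine_ge0 R _ _ (fun p => 1 - zi p) _ _ _ _ cl).
- move=> p; apply: (@continuousB R R^o _ (cst 1)); last exact: czi.
  exact: cst_continuous.
- by move=> a p q; rewrite /zi/= !mxE; ring.
- by move=> [[x' z'] t'] /(@X_set_itv _ _ _ _ i) /andP[? ?]; rewrite subr_ge0.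
Qed.

(** One template for every cut: [b = 0] with [c = l ^+ 2], [b = l ^+ 2] with [c = 0], and all
    coefficients zero for [0 <= t]. *)
Lemma closure_hull_halfspace d (a b c : R) x z t :
  (forall x z t, X_set d (x, z, t) ->
    0 <= t - a * dot d x + b * \sum_i slack d z i + c) ->
  closure (convex_hull (X_set d)) (x, z, t) ->
  0 <= t - a * dot d x + b * \sum_i slack d z i + c.
Proof.
move=> hX cl.
pose gx (p : xzt_space R n) : R^o := dot d p.1.1.
pose gz (p : xzt_space R n) : R^o := \sum_i slack d p.1.2 i.
pose gxt (p : xzt_space R n) : R^o := p.2 - a * gx p.
have cgx : continuous gx.
  move=> p; apply: (@continuous_comp _ _ _ (fun p : xzt_space R n => p.1.1)
    (dot d)).
    exact: continuous_fst_fst.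
  exact: continuous_dot.
have cgz : continuous gz.
  move=> p; apply: (@continuous_comp _ _ _ (fun p : xzt_space R n => p.1.2)
    (fun z => \sum_i slack d z i)).
    exact: continuous_fst_snd.
  apply: continuous_big => [|i _]; first exact: add_continuous.
  exact: continuous_slack.
have cgxt : continuous gxt.
  move=> p; apply: (@continuousB R R^o _ snd (fun p => a * gx p)).
    exact: cvg_snd.
  by apply: (@continuousM R _ (cst a)); [exact: cst_continuous | exact: cgx].
pose g p : R^o := gxt p + b * gz p + c.
apply: (@closure_hull_affine_ge0 R _ _ g _ _ _ _ cl).
- move=> p; apply: (@continuousD R R^o _ (fun p => gxt p + b * gz p) (cst c)).
    apply: (@continuousD R R^o _ gxt (fun p => b * gz p)); first exact: cgxt.
    by apply: (@continuousM R _ (cst b)); [exact: cst_continuous | exact: cgz].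
  exact: cst_continuous.
- move=> l p q; rewrite /g /gxt /gx /gz /= dotDr !dotZr.
  under eq_bigr do rewrite slack_affine.
  by rewrite big_split/= -!mulr_sumr /GRing.scale/=; ring.
- by move=> [[x' z'] t']; exact: hX.
Qed.

Lemma closure_hull_ge0 d x z t :
  closure (convex_hull (X_set d)) (x, z, t) -> 0 <= t.
Proof.
move=> /(@closure_hull_halfspace d 0 0 0); rewrite !mul0r subr0 !addr0; apply.
by move=> x' z' t' [_ + _]; rewrite !mul0r subr0 !addr0; apply/le_trans/sqr_ge0.
Qed.

Lemma closure_hull_den_pos d x z t :
  closure (convex_hull (X_set d)) (x, z, t) -> 0 < dot d x ->
  dot d x ^+ 2 <= t * den_pos d z.
Proof.
move=> cl dx0; apply: pos_den_cut => //.
- by apply: den_pos_ge0 => i; exact: closure_hull_cube cl.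
- exact: closure_hull_ge0 cl.
move=> l l0; rewrite den_posE; have [_|_] := leP 1 (\sum_i slack d z i).
  have := @closure_hull_halfspace d (2 * l) 0 (l ^+ 2) _ _ _ _ cl.
  suff hX x' z' t' : X_set d (x', z', t') ->
      0 <= t' - 2 * l * dot d x' + 0 * \sum_i slack d z' i + l ^+ 2.
    by move=> /(_ hX); lra.
  by case=> _ + _; have := sqr_ge0 (dot d x' - l); rewrite sqrrB; lra.
have := @closure_hull_halfspace d (2 * l) (l ^+ 2) 0 _ _ _ _ cl.
suff hX x' z' t' : X_set d (x', z', t') ->
    0 <= t' - 2 * l * dot d x' + l ^+ 2 * \sum_i slack d z' i + 0.
  by move=> /(_ hX); lra.
(* If [dot d x' <= 0], all terms are nonnegative. Otherwise the slack sum is at least 1, and the cut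
   follows from [(dot d x' - l) ^+ 2 >= 0]. *)
move=> Xp; have [dx|s1] := X_set_slack _ _ _ _ Xp; case: (Xp) => _ dt _.
  have ? : 0 <= t' by apply: le_trans dt; exact: sqr_ge0.
  have ? : 0 <= l ^+ 2 * \sum_i slack d z' i.
    rewrite mulr_ge0 ?sqr_ge0// sumr_ge0// => i _.
    by have /andP[] := slack_itv d _ _ (X_set_itv _ _ _ _ i Xp).
  have ? : 2 * l * dot d x' <= 0 by rewrite mulr_ge0_le0// mulr_ge0.
  lra.
have : l ^+ 2 <= l ^+ 2 * \sum_i slack d z' i by rewrite ler_peMr ?sqr_ge0.
by have := sqr_ge0 (dot d x' - l); rewrite sqrrB; lra.
Qed.

(** * Inner inclusion: explicit convex combinations *)

(** Induction on the number of fractional coordinates of [z]. A fractional [z i 0] forces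
    [x i 0 = 0], so it may be rounded both ways, and the two roundings average back to [z] with
    weights [z i 0] and [1 - z i 0]. *)
Lemma convex_hull_cube d x z t : (forall i, 0 <= z i 0 <= 1) ->
  dot d x ^+ 2 <= t ->
  (forall i, [\/ x i 0 = 0, 0 <= x i 0 /\ z i 0 = 1
    | x i 0 <= 0 /\ z i 0 = 0]) ->
  convex_hull (X_set d) (x, z, t).
Proof.
move=> + dt; have [k] := ubnP #|[pred i | (z i 0 != 0) && (z i 0 != 1)]|.
elim: k z => // k IH z; rewrite ltnS => zk z01 xz.
have [[i /andP[zi0 zi1]]|bin] :=
    pselect (exists i, (z i 0 != 0) && (z i 0 != 1)); last first.
  apply: subset_convex_hull; split => // i.
    have [->|zi0] := eqVneq (z i 0) 0; [by left|right].
    by apply: contra_notP bin => /eqP zi1; exists i; rewrite zi0 zi1.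
  have [->|[? ->]|[? ->]] := xz i; first by rewrite !mul0r.
    by rewrite mulr1 subrr mulr0.
  by rewrite mulr0 subr0 mulr1.
pose u (b : R) : 'cV[R]_n := \col_j (if j == i then b else z j 0).
have hu (b : R) : b = 0 \/ b = 1 -> convex_hull (X_set d) (x, u b, t).
  move=> b01; apply: IH => [|j|j].
  - apply: leq_trans zk; apply: proper_card; apply/properP; split.
      apply/fintype.subsetP => j; rewrite !inE mxE; case: (j =P i) => // _.
      by case: b01 => ->; rewrite eqxx ?andbF.
    exists i; first by rewrite inE zi0.
    by rewrite inE mxE eqxx; case: b01 => ->; rewrite eqxx ?andbF.
  - by rewrite mxE; case: ifP => // _; case: b01 => ->; rewrite ?lexx ?ler01.
  - rewrite mxE; case: (j =P i) => // ->; constructor 1.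
    by case: (xz i) => // -[_ /eqP]; rewrite (negbTE zi0, negbTE zi1).
have -> : (x, z, t) = z i 0 *: ((x, u 1, t) : xzt_space R n)
                      + (1 - z i 0) *: ((x, u 0, t) : xzt_space R n).
  congr (_, _, _).
  - by rewrite /= -scalerDl addrC subrK scale1r.
  - apply/colP => j; rewrite !mxE; case: eqP => [->|_]; ring.
  - by rewrite /= -scalerDl addrC subrK scale1r.
by apply: convex_hull_segment; [apply: hu; right|apply: hu; left|exact: z01].
Qed.

Lemma closure_hull_shift d x (y : 'cV[R]_n) z t :
  convex_hull (X_set d) (y, z, t) ->
  dot d x = dot d y -> closure (convex_hull (X_set d)) (x, z, t).
Proof.
move=> hy dxy; pose v : 'cV[R]_n := \col_i (if y i 0 <= x i 0 then 1 else 0).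
apply: (@closure_segment_end R _ _ _ ((- y, v - z, - t) : xzt_space R n)).
move=> e /andP[e0 e1].
(* A far point on a zero-cost ray: with weight [e] it moves [y] by exactly [x - y], while its effect
   on [z] and [t] vanishes as [e] tends to 0. *)
have hv : convex_hull (X_set d) (e^-1 *: (x - y), v, 0).
  apply: subset_convex_hull; split => [i||i].
  - by rewrite mxE; case: (y i 0 <= x i 0); [right|left].
  - by rewrite dotZr dotDr -[- y]scaleN1r dotZr dxy mulN1r subrr mulr0 expr0n.
  - rewrite !mxE; have [xy|xy] := leP (y i 0) (x i 0) => /=.
      by rewrite mulr1 subrr mulr0 lexx mulr_ge0 ?invr_ge0 ?subr_ge0 ?(ltW e0).
    rewrite mulr0 subr0 mulr1 lexx.
    by rewrite mulr_ge0_le0 ?invr_ge0 ?subr_le0 ?(ltW xy) ?(ltW e0).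
have -> : (x, z, t) + e *: ((- y, v - z, - t) : xzt_space R n) =
    e *: ((e^-1 *: (x - y), v, 0) : xzt_space R n) +
    (1 - e) *: ((y, z, t) : xzt_space R n).
  congr (_, _, _).
  - rewrite /= scalerA divff ?gt_eqF// scale1r.
    by apply/colP => j; rewrite !mxE; ring.
  - by apply/colP => j; rewrite !mxE; ring.
  - by rewrite /= /GRing.scale/=; ring.
by apply: convex_hull_segment => //; rewrite e1 ltW.
Qed.

Lemma closure_hull_pos d x z t : (forall i, 0 <= z i 0 <= 1) ->
  0 < dot d x -> dot d x ^+ 2 <= t * den_pos d z ->
  closure (convex_hull (X_set d)) (x, z, t).
Proof.
move=> z01; set s := dot d x => s0 sle.
set m := den_pos d z in sle *; have m_ge0 : 0 <= m by exact: den_pos_ge0.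
have s2 : 0 < s ^+ 2 by rewrite exprn_gt0.
have m0 : 0 < m.
  rewrite lt_neqAle m_ge0 andbT.
  by apply: contraTneq sle => <-; rewrite mulr0 -ltNge.
have t0 : 0 < t by rewrite -(pmulr_lgt0 _ m0); exact: lt_le_trans sle.
set y := slack d z; have y01 i : 0 <= y i <= 1 by apply: slack_itv.
pose L := \sum_i y i; have mE : m = Num.min 1 L by exact: den_posE.
have m1 : m <= 1 by rewrite mE ge_min lexx.
have mL : m <= L by rewrite mE ge_min lexx orbT.
have L0 : 0 < L by exact: lt_le_trans mL.
(* The slacks are scaled down to total [m]; [m <= L] keeps each weight below its slack, which is
   what places [w] in the unit cube. *)
pose l i := y i * (m / L).
have l0 i : 0 <= l i.
  by have /andP[? _] := y01 i; rewrite mulr_ge0// divr_ge0// ltW.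
have ly i : l i <= y i.
  by have /andP[? _] := y01 i; rewrite ler_piMr// ler_pdivrMr// mul1r.
have suml : \sum_i l i = m.
  by rewrite -mulr_suml -/L mulrC divfK ?gt_eqF.
pose b i : R := if 0 < d i 0 then 1 else 0.
(* If l j = 1 then the quotient is 0, which is harmless since z_j = b j. *)
pose w : 'cV[R]_n := \col_j ((z j 0 - l j * b j) / (1 - l j)).
(* The left side is coordinate [j] of the final combination: only the [j]-th point differs from [w]
   there, so [w] carries the remaining weight [1 - l j]. *)
have wE j : l j * b j + (1 - l j) * w j 0 = z j 0.
  rewrite mxE; have [lj1|lj1] := eqVneq (1 - l j) 0.
    rewrite lj1 mul0r addr0; have {}lj1 : l j = 1 by lra.
    have : y j = 1 by have := ly j; have /andP[] := y01 j; lra.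
    rewrite lj1 mul1r /y /slack /b; case: ltgtP => _ //=; lra.
  by rewrite mulrC [X in _ + X]mulrC divfK// mulrC addrC subrK.
have w01 j : 0 <= w j 0 <= 1.
  rewrite mxE; have := ly j; have /andP[yj0 yj1] := y01 j; have := l0 j.
  have [->|lj1] := eqVneq (l j) 1.
    by rewrite subrr invr0 mulr0 lexx ler01.
  move=> lj0 ljy; have {}lj1 : 0 < 1 - l j.
    by rewrite subr_gt0 lt_neqAle lj1 (le_trans ljy).
  rewrite divr_ge0 ?ler_pdivrMr ?mul1r//=; last exact: ltW.
    have /andP[_ zj1] := z01 j.
    by move: ljy; rewrite /y /slack /b; case: ltgtP => _ /=; lra.
  have /andP[zj0 _] := z01 j.
  by move: ljy; rewrite /y /slack /b; case: ltgtP => _ /=; lra.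
pose u i : 'cV[R]_n := \col_j (if j == i then b i else w j 0).
(* The first component has [dot d] equal to [s / m], and [s ^+ 2 <= t * m] gives
   [(s / m) ^+ 2 <= t / m]. If [d i 0 = 0] the division is meaningless, but then [l i = 0]. *)
pose p i : xzt_space R n := ((s / m / d i 0) *: delta_mx i 0, u i, t / m).
have d_neq0 i : l i != 0 -> d i 0 != 0.
  by apply: contraNneq => di0; rewrite /l /y /slack di0 ltxx mul0r.
have hp i : l i != 0 -> convex_hull (X_set d) (p i).
  move=> /d_neq0 di0; apply: convex_hull_cube => [j||j].
  - rewrite mxE; case: ifP => // _; rewrite /b.
    by case: ltP; rewrite /= ?lexx ?ler01.
  - rewrite dotZr dot_delta divfK// expr_div_n expr2 invfM mulrA.
    by rewrite ler_pM2r ?invr_gt0// ler_pdivrMr.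
  - rewrite !mxE eqxx andbT; have [_|_] := eqVneq j i; last first.
      by constructor 1; rewrite mulr0.
    rewrite mulr1 /b; case: ltP di0 => [di _|].
      by constructor 2; rewrite !divr_ge0// ltW.
    rewrite le_eqVlt => /orP[/eqP->|di _]; first by rewrite eqxx.
    constructor 3; split=> //.
    by rewrite mulr_ge0_le0 ?invr_le0 ?(ltW di)// divr_ge0// ltW.
have hq : convex_hull (X_set d) (0, w, 0).
  apply: convex_hull_cube => // [|i]; first by rewrite dot0r expr0n.
  by constructor 1; rewrite mxE.
have := convex_hull_sum _ _ l p _ l0 hp hq; rewrite suml => /(_ m1).
set c := (X in convex_hull _ X) => hc.
have c1 : dot d c.1.1 = s.
  rewrite /c /= !(raddf_sum fst)/= scaler0 addr0.
  rewrite (big_morph (dot d) (dotDr d) (dot0r d)).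
  rewrite -[RHS](divfK (_ : m != 0)) ?gt_eqF// -suml mulr_sumr.
  apply: eq_bigr => i _.
  rewrite dotZr; have [->|li0] := eqVneq (l i) 0; first by rewrite mul0r mulr0.
  by rewrite suml mulrC dotZr dot_delta divfK// d_neq0.
have c2 : c.1.2 = z.
  rewrite /c /= !(raddf_sum fst) (raddf_sum snd)/=; apply/colP => j.
  rewrite !mxE summxE -[RHS]wE -suml (bigD1 j)//=.
  rewrite [in X in 1 - X](bigD1 j)//= !mxE eqxx.
  have -> : \sum_(i | i != j) (l i *: u i) j 0 =
      (\sum_(i | i != j) l i) * w j 0.
    rewrite mulr_suml; apply: eq_bigr => i ij.
    by rewrite !mxE eq_sym (negbTE ij).
  by rewrite [in LHS]mxE; ring.
have c3 : c.2 = t.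
  rewrite /c /= (raddf_sum snd)/= scaler0 addr0 -mulr_suml suml.
  by rewrite mulrC divfK ?gt_eqF.
(* The combination matches [z] and [t], but its first component agrees with [x] only under [dot d];
   the shift repairs this. *)
clearbody c; case: c hc c1 c2 c3 => -[x0 z0 t'] /= hc c1 cz ct.
by move: hc; rewrite cz ct => hc; exact: closure_hull_shift hc (esym c1).
Qed.

Lemma closure_hull_zero d x z t : (forall i, 0 <= z i 0 <= 1) ->
  dot d x = 0 -> 0 <= t -> closure (convex_hull (X_set d)) (x, z, t).
Proof.
move=> z01 dx0 t0; apply: (@closure_hull_shift _ _ 0); last first.
  by rewrite dx0 dot0r.
apply: convex_hull_cube => // [|i]; first by rewrite dot0r expr0n.
by constructor 1; rewrite mxE.
Qed.

(** * Removing the extended-real quotients, and the conclusion *)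

(** For [m = 0] both sides are false: the quotient is [+oo], and [a <= 0] fails. *)
Lemma le_div_ereal (a m t : R) : 0 < a -> 0 <= m ->
  (a%:E / m%:E <= t%:E)%E = (a <= t * m).
Proof.
move=> a0; rewrite le_eqVlt => /orP[/eqP<-|m0].
  by rewrite divr0_ereal// mulr0 leye_eq [RHS]leNgt a0.
by rewrite inver gt_eqF// -EFinM lee_fin ler_pdivrMr.
Qed.

(** At most one of the two parts of [s] is nonzero, and a zero numerator gives a zero quotient even
    over a zero denominator. *)
Lemma le_hull_formula s m1 m2 t : 0 <= m1 -> 0 <= m2 ->
  ((pos_part s ^+ 2)%:E / m1%:E + (neg_part s ^+ 2)%:E / m2%:E <= t%:E)%E =
  if 0 < s then s ^+ 2 <= t * m1
  else if s < 0 then s ^+ 2 <= t * m2 else 0 <= t.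
Proof.
move=> m10 m20; rewrite /pos_part /neg_part.
case: (ltgtP 0 s) => [s0|s0|_]; rewrite ?expr0n ?mul0e ?adde0 ?add0e ?lee_fin//.
  by rewrite le_div_ereal ?exprn_gt0.
by rewrite le_div_ereal// exprn_even_gt0//= lt_eqF.
Qed.

End Hull.

Theorem theorem1 (R : realType) (n : nat) (hn : (1 <= n)%N) (d : 'cV[R]_n) :
  closure (convex_hull (X_set d)) = hull_formula d.
Proof.
apply/seteqP; split => -[[x z] t].
  move=> cl; have z01 i : 0 <= z i 0 <= 1 by exact: closure_hull_cube cl.
  split=> //; rewrite den_negE le_hull_formula ?den_pos_ge0//.
  case: ltgtP => [dx0|dx0|_].
  - exact: closure_hull_den_pos cl dx0.
  (* A negative value of the form is the positive case for [- d], which has the same [X_set]. *)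
  - rewrite -sqrrN -dotNl; apply: (@closure_hull_den_pos _ _ _ x).
      by rewrite X_setN.
    by rewrite dotNl oppr_gt0.
  - exact: closure_hull_ge0 cl.
move=> [z01]; rewrite den_negE le_hull_formula ?den_pos_ge0//.
case: ltgtP => [dx0|dx0|dx0] h.
- exact: closure_hull_pos.
- by rewrite -X_setN; apply: closure_hull_pos; rewrite ?dotNl ?sqrrN ?oppr_gt0.
- exact: closure_hull_zero.
Qed.
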